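(* Let $G$ be a chain graph. Then: (1) $\chi_{pcf}(G)=1$ if and only if $|E(G)|=0$. (2) $\chi_{pcf}(G)=2$ if and only if $|E(G)|=1$. (3) $\chi_{pcf}(G)=3$ if and only if $|E(G)|\geq 2$ and $G$ has at most two vertices of degree at least $2$. (4) $\chi_{pcf}(G)=4$ otherwise.
   Context: All graphs are finite, simple, connected and undirected. $N(v)$ is the open neighborhood of $v$ and $[k]=\{1,\dots,k\}$. A proper conflict-free (PCF) $k$-coloring of a graph $G$ is a proper coloring $f:V(G)\to[k]$ such that for every non-isolated vertex $v$ there is a color (depending on $v$) that appears on exactly one vertex of $N(v)$. $\chi_{pcf}(G)$ is the least $k$ such that $G$ admits a PCF $k$-coloring. A bipartite graph $G=(X,Y,E)$ is a chain graph if there exist orderings $(x_1,\ldots,x_p)$ of $X$ and $(y_1,\ldots,y_q)$ of $Y$ such that $N(x_1)\subseteq N(x_2)\subseteq\cdots\subseteq N(x_p)$ and $N(y_1)\supseteq N(y_2)\supseteq\cdots\supseteq N(y_q)$. *)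

(* Defs.v *)
From mathcomp Require Import all_boot.

Set Implicit Arguments.
Unset Strict Implicit.
Unset Printing Implicit Defensive.

Record sgraph := SGraph {
  vertex :> finType;
  adj : rel vertex;
  adj_sym : symmetric adj;
  adj_irrefl : irreflexive adj
}.

Definition nbh (G : sgraph) (v : G) : {set G} := [set u | adj v u].

Definition degree (G : sgraph) (v : G) : nat := #|nbh v|.

(* Edges are unordered pairs, so each edge is counted once in #|edges G|. *)
Definition edges (G : sgraph) : {set {set G}} :=
  [set [set p.1; p.2] | p : G * G & adj p.1 p.2].

(* The graph without vertices does not count as connected; the one-vertex
   graph does. *)
Definition connected_graph (G : sgraph) : Prop :=
  0 < #|G| /\ forall x y : G, connect (@adj G) x y.

Definition bipartition (G : sgraph) (X Y : {set G}) : Prop :=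
  [/\ X :|: Y = [set: G], [disjoint X & Y] &
      forall u v : G, adj u v -> (u \in X) && (v \in Y) || (u \in Y) && (v \in X)].

Definition ordering (T : finType) (A : {set T}) (s : seq T) : Prop :=
  uniq s /\ s =i A.

(* A part of the bipartition may be empty, so the one-vertex graph is a chain
   graph. *)
Definition chain_graph (G : sgraph) : Prop :=
  exists X Y : {set G}, bipartition X Y /\
  exists xs ys : seq G,
    [/\ ordering X xs, ordering Y ys,
        sorted (fun u v : G => nbh u \subset nbh v) xs &
        sorted (fun u v : G => nbh v \subset nbh u) ys].

Definition proper_coloring (G : sgraph) (k : nat) (f : {ffun G -> 'I_k}) : bool :=
  [forall u, forall v, adj u v ==> (f u != f v)].

Definition conflict_free (G : sgraph) (k : nat) (f : {ffun G -> 'I_k}) : bool :=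
  [forall v, (nbh v != set0) ==>
     [exists c : 'I_k, #|[set u in nbh v | f u == c]| == 1]].

Definition pcf_colorable (G : sgraph) (k : nat) : bool :=
  [exists f : {ffun G -> 'I_k}, proper_coloring f && conflict_free f].

Lemma pcf_colorable_card (G : sgraph) : pcf_colorable G #|G|.
Proof.
apply/existsP; exists [ffun v => enum_rank v]; apply/andP; split.
  apply/forallP=> u; apply/forallP=> v; apply/implyP=> uv.
  rewrite !ffunE (inj_eq enum_rank_inj).
  by apply: contraTneq uv => ->; rewrite adj_irrefl.
apply/forallP=> v; apply/implyP=> /set0Pn [w vw].
apply/existsP; exists (enum_rank w); apply/cards1P; exists w.
apply/setP=> u; rewrite !inE ffunE (inj_eq enum_rank_inj).
by case: eqP => [->|_]; rewrite ?andbF // andbT; move: vw; rewrite inE.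
Qed.

Definition chi_pcf (G : sgraph) : nat :=
  ex_minn (ex_intro (fun k => pcf_colorable G k) #|G| (pcf_colorable_card G)).

(* Main.v *)
Require Import Defs.
From mathcomp Require Import all_boot.

(** In a connected chain graph with an edge, the vertices [a] and [b] with the
    largest neighborhoods on the two sides are adjacent and every vertex sees
    one of them. Hence any proper coloring in which the colors of [a] and [b]
    are not reused is conflict-free; giving one more color to the rest of each
    side uses 4 colors, and a single extra color suffices when no edge avoids
    both [a] and [b], which is the case when at most two vertices have degree
    at least 2. Conversely, a vertex of degree at least 2 sees two colors
    besides its own. If a third vertex [u], say on the side of [a], has degree
    at least 2, then it has a neighbor [w] whose color is not that of [b];
    [w] sees [u] and [a], hence two colors which differ from those of [w] and
    [b]: four colors in total. *)

Set Implicit Arguments.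
Unset Strict Implicit.

(** * Consequences of colorability for adjacency and degrees *)

Lemma chi_pcfP (G : sgraph) : pcf_colorable G (chi_pcf G).
Proof. by rewrite /chi_pcf; case: ex_minnP. Qed.

Lemma chi_pcf_min (G : sgraph) k : pcf_colorable G k -> chi_pcf G <= k.
Proof. by rewrite /chi_pcf; case: ex_minnP => m _; apply. Qed.

Lemma pcf_colorableP (G : sgraph) k :
  pcf_colorable G k -> exists f : {ffun G -> 'I_k},
    (forall u v, adj u v -> f u != f v) /\ conflict_free f.
Proof.
case/existsP=> f /andP[/forallP fP fC]; exists f; split=> // u v.
by have /forallP/(_ v)/implyP := fP u.
Qed.

Lemma pcf_colorable0 (G : sgraph) : 0 < #|G| -> ~~ pcf_colorable G 0.
Proof. by case/card_gt0P=> v _; apply/existsP=> -[f _]; case: (f v). Qed.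

Lemma pcf_colorable1 (G : sgraph) (u v : G) :
  pcf_colorable G 1 -> ~~ adj u v.
Proof.
by case/pcf_colorableP=> f [fP _]; apply/negP=> /fP; rewrite !ord1.
Qed.

(** Take for [w1] the neighbor whose color is unique around [v]; every other neighbor can serve as
    [w2]. *)
Lemma conflict_free_degree2 (G : sgraph) k (f : {ffun G -> 'I_k}) v :
  conflict_free f -> 1 < degree v ->
  exists w1 w2, [/\ adj v w1, adj v w2 & f w1 != f w2].
Proof.
move=> /forallP/(_ v) fC dv.
have : nbh v != set0 by rewrite -card_gt0 ltnW.
move/(implyP fC)/existsP=> [c /cards1P[w wE]].
have : w \in [set u in nbh v | f u == c] by rewrite wE set11.
rewrite !inE => /andP[vw /eqP fw].
have [w' w'v w'w] : exists2 w', w' \in nbh v & w' != w.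
  have : 0 < #|nbh v :\ w|.
    by move: dv; rewrite /degree (cardsD1 w) inE vw.
  by case/card_gt0P=> w'; rewrite in_setD1 => /andP[]; exists w'.
exists w, w'; split=> //; first by move: w'v; rewrite inE.
apply: contraNneq w'w => fww'.
by rewrite -in_set1 -wE inE w'v -fww' fw eqxx.
Qed.

Lemma degree_gt1 (G : sgraph) (v w1 w2 : G) :
  adj v w1 -> adj v w2 -> w1 != w2 -> 1 < degree v.
Proof.
move=> v1 v2 n12; have <- : #|[set w1; w2]| = 2 by rewrite cards2 n12.
by apply: subset_leq_card; apply/subsetP=> w; rewrite !inE => /pred2P[]->.
Qed.

Lemma uniq_ord_size k (s : seq 'I_k) : uniq s -> size s <= k.
Proof. by move/card_uniqP=> <-; rewrite -[leqRHS]card_ord max_card. Qed.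

Lemma pcf_colorable2_degree (G : sgraph) (v : G) :
  pcf_colorable G 2 -> degree v <= 1.
Proof.
case/pcf_colorableP=> f [fP fC]; rewrite leqNgt; apply/negP=> dv.
have [w1 [w2 [v1 v2 n12]]] := conflict_free_degree2 fC dv.
suff /uniq_ord_size : uniq [:: f v; f w1; f w2] by [].
by rewrite /= !inE negb_or n12 !fP.
Qed.

Lemma edges_gt0P (G : sgraph) :
  reflect (exists u v : G, adj u v) (0 < #|edges G|).
Proof.
apply: (iffP card_gt0P) => [[_ /imsetP[[u v] uv _]]|[u [v uv]]].
  by exists u, v; rewrite inE in uv.
by exists [set u; v]; apply/imsetP; exists (u, v); rewrite ?inE.
Qed.

(** * The dominating edge of a connected chain graph *)

Lemma sorted_nbh_max (G : sgraph) (s : seq G) (x : G) :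
  sorted (fun u v : G => nbh v \subset nbh u) s -> x \in s ->
  exists2 m, m \in s & {in s, forall z, nbh z \subset nbh m}.
Proof.
case: s => // m s /order_path_min sP _; exists m; rewrite ?mem_head // => z.
rewrite inE => /predU1P[->//|zs]; apply: (allP (sP _)) zs => u v w vu wv.
exact: subset_trans wv vu.
Qed.

Lemma connected_nbh (G : sgraph) (v w : G) :
  connected_graph G -> v != w -> exists u, adj v u.
Proof.
case=> _ /(_ v w)/connectP[[|u p] /=]; first by move=> _ ->; rewrite eqxx.
by case/andP=> vu _ _; exists u.
Qed.

(** The second side is the complement of [X], so complementation exchanges the roles of [a] and [b].
    Their adjacency is the fourth clause at [a]. *)
Definition dominating_edge (G : sgraph) (X : {set G}) (a b : G) : Prop :=
  [/\ a \in X, b \notin X, forall u v, adj u v -> (u \in X) != (v \in X),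
      forall x, x \in X -> adj x b & forall y, y \notin X -> adj y a].

Lemma dominating_edgeC (G : sgraph) (X : {set G}) a b :
  dominating_edge X a b -> dominating_edge (~: X) b a.
Proof.
case=> aX bX XP Xb Ya; split; rewrite ?inE ?negbK //.
- by move=> u v /XP; rewrite !inE; case: (u \in X); case: (v \in X).
- by move=> x; rewrite inE => /Ya.
- by move=> y; rewrite inE negbK => /Xb.
Qed.

Lemma chain_dominating_edge (G : sgraph) (u0 v0 : G) :
  connected_graph G -> chain_graph G -> adj u0 v0 ->
  exists X a b, @dominating_edge G X a b.
Proof.
move=> Gconn [X [Y [[XY dXY bip] [xs [ys [[_ xsX] [_ ysY] xsS ysS]]]]]] uv0.
have YE v : (v \in Y) = (v \notin X).
  have := in_setT v; rewrite -XY inE; case: (boolP (v \in X)) => //= vX _.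
  exact: (disjointFr dXY).
have bipX u v : adj u v -> (u \in X) != (v \in X).
  by move/bip; rewrite !YE; case: (u \in X); case: (v \in X).
have [x [y [xX yY]]] : exists x y, x \in X /\ y \in Y.
  by case/orP: (bip _ _ uv0) => /andP[]; [exists u0, v0|exists v0, u0].
(* Each [v] differs from [x] or from [y], so connectivity gives it a neighbor. *)
have hasN (v : G) : exists u, adj v u.
  have [vx|vx] := eqVneq v x; last exact: connected_nbh vx.
  apply: (connected_nbh (w := y)) => //.
  by apply: contraTneq yY => <-; rewrite vx YE xX.
(* Neighborhoods grow along [xs]; reversal puts a largest one first. *)
have [a aX aP] : exists2 m, m \in rev xs &
    {in rev xs, forall z, nbh z \subset nbh m}.
  by apply: (@sorted_nbh_max _ _ x); rewrite ?rev_sorted // mem_rev xsX.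
have [b bY bP] : exists2 m, m \in ys & {in ys, forall z, nbh z \subset nbh m}.
  by apply: (@sorted_nbh_max _ _ y); rewrite ?ysY.
exists X, a, b; split=> //.
- by rewrite -xsX -mem_rev.
- by rewrite -YE -ysY.
(* Some [u] in [Y] is adjacent to [v], and [nbh u] is contained in [nbh b]; so [b] is adjacent to
   [v]. *)
- move=> v vX; have [u vu] := hasN v.
  have uY : u \in ys by rewrite ysY YE; move: (bipX _ _ vu); rewrite vX.
  by have /subsetP/(_ v) := bP u uY; rewrite !inE adj_sym vu [adj b v]adj_sym; apply.
- move=> v vY; have [u vu] := hasN v.
  have uX : u \in rev xs.
    by rewrite mem_rev xsX; move: (bipX _ _ vu); rewrite (negbTE vY); case: (u \in X).
  by have /subsetP/(_ v) := aP u uX; rewrite !inE adj_sym vu [adj a v]adj_sym; apply.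
Qed.

(** * Colorings built on a dominating edge *)

Lemma dominating_edge_pcf (G : sgraph) (X : {set G}) a b k (c : G -> nat) :
  dominating_edge X a b ->
  (forall v, v \notin [set a; b] -> c v < k) ->
  (forall u v, adj u v -> u \notin [set a; b] -> v \notin [set a; b] ->
     c u != c v) ->
  pcf_colorable G k.+2.
Proof.
case=> aX bX XP Xb Ya ck cP.
(* Colors 0 and 1 are reserved for [a] and [b]; the shift by 2 keeps [c] away from them. *)
pose g v := if v == a then 0 else if v == b then 1 else (c v).+2.
have gk v : g v < k.+2.
  rewrite /g; case: eqVneq => // va; case: eqVneq => // vb.
  by rewrite !ltnS ck // !inE negb_or va.
have gP u v : adj u v -> g u != g v.
  move=> uv; have uDv : u != v by apply: contraTneq uv => ->; rewrite adj_irrefl.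
  rewrite /g; move: uDv (cP _ _ uv); rewrite !inE.
  case: (eqVneq u a) => [->|_]; case: (eqVneq v a) => [_|_];
    rewrite //=; try by case: ifP.
  case: (eqVneq u b) => [->|_]; case: (eqVneq v b) => [_|_] //=.
  by rewrite !eqSS => _; apply.
have ab : b != a by apply: contraNneq bX => ->.
have gU w u : w \in [set a; b] -> g u = g w -> u = w.
  rewrite !inE /g => /pred2P[]->; rewrite ?eqxx ?(negbTE ab);
  by case: (eqVneq u a) => [->|_] //; case: (eqVneq u b) => [->|_].
have fE u v : (inord (g u) == inord (g v) :> 'I_k.+2) = (g u == g v).
  by rewrite -val_eqE /= !inordK.
apply/existsP; exists [ffun v => inord (g v)].
apply/andP; split; apply/forallP=> v.
  by apply/forallP=> w; apply/implyP; rewrite !ffunE fE; apply: gP.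
apply/implyP=> _.
have [w vw wab] : exists2 w, adj v w & w \in [set a; b].
  by case: (boolP (v \in X)) => [/Xb|/Ya]; [exists b|exists a];
     rewrite // !inE eqxx ?orbT.
apply/existsP; exists (inord (g w)); apply/cards1P; exists w; apply/setP=> u.
rewrite !inE ffunE fE; apply/andP/eqP => [[_ /eqP/(gU _ _ wab)]//|->].
by rewrite vw eqxx.
Qed.

Lemma dominating_edge_pcf4 (G : sgraph) (X : {set G}) a b :
  dominating_edge X a b -> pcf_colorable G 4.
Proof.
move=> D; have [_ _ XP _ _] := D.
(* The side of a vertex is its color: every edge joins the two sides. *)
apply: (dominating_edge_pcf (c := fun v => nat_of_bool (v \in X)) D) => [v _|u v].
  by case: (v \in X).
by move=> /XP; case: (u \in X); case: (v \in X).
Qed.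

Lemma dominating_edge_pcf3 (G : sgraph) (X : {set G}) a b :
  dominating_edge X a b -> #|[set v : G | 2 <= degree v]| <= 2 ->
  pcf_colorable G 3.
Proof.
move=> D; rewrite leqNgt => /negP few.
(* The constant [c] fails only at an edge avoiding [a] and [b]; such an edge yields three vertices
   of degree at least 2. *)
apply: (dominating_edge_pcf (c := fun => 0) D) => // u v uv uab vab; case: few.
have {u v uv uab vab} [u [v [uX vX uv ua vb]]] : exists u v,
    [/\ u \in X, v \notin X, adj u v, u != a & v != b].
  move: uab vab (uv); rewrite adj_sym !inE !negb_or.
  move=> /andP[ua ub] /andP[va vb] vu; case: D => _ _ /(_ _ _ uv) + _ _.
  case: (boolP (u \in X)) => uX; case: (boolP (v \in X)) => vX // _.
    by exists u, v.
  by exists v, u.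
have [aX bX _ Xb Ya] := D.
have uDv : u != v by apply: contraNneq vX => <-.
have vDa : v != a by apply: contraNneq vX => ->.
have bDv : b != v by rewrite eq_sym.
(* Both [a] and [u] see [b] and [v], while [v] sees [a] and [u]. *)
have <- : #|[set a; u; v]| = 3.
  by rewrite setUC cardsU1 cards2 !inE negb_or vDa (eq_sym a) ua (eq_sym v) uDv.
apply: subset_leq_card; apply/subsetP=> w; rewrite !inE -orbA => /or3P[]/eqP->.
- by apply: (@degree_gt1 _ _ b v); rewrite ?Xb // adj_sym Ya.
- by apply: (@degree_gt1 _ _ b v); rewrite ?Xb.
- by apply: (@degree_gt1 _ _ a u); rewrite ?Ya // 1?adj_sym // eq_sym.
Qed.

(** * Degree bounds forced by three colors *)

Lemma pcf3_degree (G : sgraph) (X : {set G}) a b u :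
  dominating_edge X a b -> pcf_colorable G 3 -> u \in X -> u != a ->
  degree u <= 1.
Proof.
move=> [aX bX XP Xb Ya] /pcf_colorableP[f [fP fC]] uX ua.
rewrite leqNgt; apply/negP=> du.
have [w uw wb] : exists2 w, adj u w & f w != f b.
  have [w1 [w2 [u1 u2 n12]]] := conflict_free_degree2 fC du.
  have [e1|n1] := eqVneq (f w1) (f b); last by exists w1.
  by exists w2; rewrite // -e1 eq_sym.
have wX : w \notin X by move: (XP _ _ uw); rewrite uX; case: (w \in X).
have dw : 1 < degree w.
  by apply: (@degree_gt1 _ _ u a); rewrite ?Ya // adj_sym.
have [z1 [z2 [w1 w2 n12]]] := conflict_free_degree2 fC dw.
have zX z : adj w z -> z \in X.
  by move/XP; rewrite (negbTE wX); case: (z \in X).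
(* Since [z1] and [z2] lie in [X], both are adjacent to [b] as well as to [w]. *)
suff /uniq_ord_size : uniq [:: f w; f b; f z1; f z2] by [].
by rewrite /= !inE !negb_or wb n12 !fP // adj_sym Xb ?zX.
Qed.

Lemma pcf3_card_degree2 (G : sgraph) (X : {set G}) a b :
  dominating_edge X a b -> pcf_colorable G 3 ->
  #|[set v : G | 2 <= degree v]| <= 2.
Proof.
move=> D G3; have : #|[set a; b]| <= 2 by rewrite cards2; case: (a != b).
apply: leq_trans; apply: subset_leq_card; apply/subsetP=> u; rewrite !inE.
apply: contraTT; rewrite negb_or -leqNgt => /andP[ua ub].
have [uX|uX] := boolP (u \in X); first exact: pcf3_degree D G3 uX ua.
by apply: pcf3_degree (dominating_edgeC D) G3 _ ub; rewrite inE.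
Qed.

(** On the side of [a], both [u] and [a] are neighbors of [b], which has only one; the other side is
    symmetric. *)
Lemma dominating_edge_degree1 (G : sgraph) (X : {set G}) a b u :
  dominating_edge X a b -> (forall v : G, degree v <= 1) -> u \in [set a; b].
Proof.
case=> aX bX _ Xb Ya deg1; rewrite !inE.
have eqN (v w1 w2 : G) : adj v w1 -> adj v w2 -> w1 = w2.
  move=> v1 v2; apply/eqP; apply: contraTT (deg1 v); rewrite -ltnNge.
  exact: degree_gt1.
have [/Xb ub|/Ya ua] := boolP (u \in X); last first.
  by rewrite (eqN a u b) ?eqxx ?orbT ?Xb // adj_sym.
by rewrite (eqN b u a) ?eqxx ?Ya // adj_sym.
Qed.

(** * Graphs with at most one edge *)

Lemma dominating_edge_edges1 (G : sgraph) (X : {set G}) a b :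
  dominating_edge X a b ->
  #|edges G| = 1 <-> forall u : G, u \in [set a; b].
Proof.
move=> [aX bX XP Xb Ya].
have edgeE (u v : G) : adj u v -> [set u; v] \in edges G.
  by move=> uv; apply/imsetP; exists (u, v); rewrite ?inE.
have ab := edgeE _ _ (Xb _ aX).
split=> [/eqP/cards1P[e eE] u|uab].
  have [w [uw wab]] : exists w, adj u w /\ w \in [set a; b].
    by case: (boolP (u \in X)) => [/Xb|/Ya]; [exists b|exists a];
       rewrite !inE eqxx ?orbT.
  (* The edges [uw] and [ab] both equal the single edge [e], so [u] is an end of [ab]. *)
  move: (edgeE _ _ uw) ab; rewrite eE !in_set1 => /eqP <- /eqP ->.
  by rewrite !inE eqxx.
apply/eqP/cards1P; exists [set a; b]; apply/setP=> e; rewrite inE.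
apply/idP/eqP=> [/imsetP[[u v] + ->]|->//].
move: (uab u) (uab v); rewrite !inE.
by move=> /pred2P[]-> /pred2P[]->; rewrite ?adj_irrefl // setUC.
Qed.

Lemma edges1_pcf2 (G : sgraph) (X : {set G}) a b :
  dominating_edge X a b -> #|edges G| = 1 <-> pcf_colorable G 2.
Proof.
move=> D; apply: iff_trans (dominating_edge_edges1 D) _; split=> [uab|G2 u].
  (* Here [k] is 0: no vertex lies outside [[set a; b]], and [c] is a dummy value. *)
  by apply: (dominating_edge_pcf (c := fun => 0) D) => [v|u v _]; rewrite uab.
by apply: dominating_edge_degree1 D _ => v; apply: pcf_colorable2_degree.
Qed.

Lemma edges0_pcf1 (G : sgraph) :
  connected_graph G -> #|edges G| = 0 -> pcf_colorable G 1.
Proof.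
move=> Gconn E0; have noadj (u v : G) : adj u v = false.
  by apply/negP=> uv; have /edges_gt0P : exists u v : G, adj u v;
     [exists u, v | rewrite E0].
apply/existsP; exists [ffun => ord0]; apply/andP; split; apply/forallP=> v.
  by apply/forallP=> w; rewrite noadj.
by apply/implyP=> /set0Pn[w]; rewrite inE noadj.
Qed.

Theorem theorem8 (G : sgraph) (Gconn : connected_graph G)
    (Gchain : chain_graph G) :
  (chi_pcf G = 1 <-> #|edges G| = 0) /\
  (chi_pcf G = 2 <-> #|edges G| = 1) /\
  (chi_pcf G = 3 <->
     2 <= #|edges G| /\ #|[set v : G | 2 <= degree v]| <= 2) /\
  (~ (#|edges G| = 0) ->
   ~ (#|edges G| = 1) ->
   ~ (2 <= #|edges G| /\ #|[set v : G | 2 <= degree v]| <= 2) ->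
   chi_pcf G = 4).
Proof.
have chiP := chi_pcfP G; have chi_min := @chi_pcf_min G.
have chi_gt0 : chi_pcf G != 0.
  by apply: contraTneq chiP => ->; apply: pcf_colorable0; case: Gconn.
have [E0|/edges_gt0P[u [v uv]]] := posnP #|edges G|.
  have : chi_pcf G = 1.
    by have := chi_min _ (edges0_pcf1 Gconn E0); case: (chi_pcf G) chi_gt0 => [|[]].
  by rewrite E0 => ->; do !split=> //; case.
have [X [a [b D]]] := chain_dominating_edge Gconn Gchain uv.
have E_gt0 : 0 < #|edges G| by apply/edges_gt0P; exists u, v.
have chi_neq1 : chi_pcf G != 1.
  by apply: contraTneq uv => chi1; rewrite chi1 in chiP; apply: pcf_colorable1.
have e2 := edges1_pcf2 D.
have e3 := dominating_edge_pcf3 D; have e3' := pcf3_card_degree2 D.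
(* From here [chi_pcf G] is 2, 3 or 4, and each value is settled by excluding the others. *)
have chi4 := chi_min _ (dominating_edge_pcf4 D).
have chi2 : chi_pcf G = 2 <-> #|edges G| = 1.
  split=> [chi2|/e2/chi_min]; first by apply/e2; rewrite -chi2.
  by case: (chi_pcf G) chi_gt0 chi_neq1 => [|[|[]]].
have chi3 : chi_pcf G = 3 <->
    2 <= #|edges G| /\ #|[set v : G | 2 <= degree v]| <= 2.
  split=> [chi3|[E2 /e3/chi_min]].
    split; last by apply: e3'; rewrite -chi3.
    by rewrite ltn_neqAle E_gt0 andbT eq_sym; apply/eqP=> /chi2; rewrite chi3.
  have : chi_pcf G <> 2 by move/chi2 => E1; rewrite E1 in E2.
  by case: (chi_pcf G) chi_gt0 chi_neq1 => [|[|[|[]]]].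
split; last split=> //; last split=> // _ /chi2 chi_neq2 /chi3 chi_neq3.
  by split=> [chi1|E0]; [rewrite chi1 in chi_neq1|rewrite E0 in E_gt0].
by move: chi_gt0 chi_neq1 chi_neq2 chi_neq3 chi4; case: (chi_pcf G) => [|[|[|[|[]]]]].
Qed.
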